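(* Let $(K,[\cdot,\cdot],J)$ be a Krein space of finite dimension $N$, and let $\{f_i:i\in I\}$ be a (finite) weakly normalized $\zeta$-$J$-frame for $K$. Let $M_+=\overline{\mathrm{span}}\{f_i:i\in I_+\}$, $M_-=\overline{\mathrm{span}}\{f_i:i\in I_-\}$, $\dim M_+=m$, $\dim M_-=n$, $|I_+|=p$ and $|I_-|=q$. Then the minimum value of the $J$-frame potential $FP_J$ among weakly normalized $\zeta$-$J$-frames for $K$ with these values of $m,n,p,q$ is $$\frac{p^2}{m}+\frac{q^2}{n},$$ and this minimum is attained exactly when the frame vectors form a weakly normalized $\zeta$-$J$-tight frame for $K$ for some $\zeta\in[\sqrt2,2)$.
   Context: A Krein space $(K,[\cdot,\cdot],J)$ is a vector space over $F=\mathbb{R}$ or $\mathbb{C}$ with a conjugate-symmetric form $[\cdot,\cdot]$, linear in the first variable, admitting a decomposition $K=K^+[\dot{+}]K^-$ into a direct sum, orthogonal with respect to $[\cdot,\cdot]$, such that $(K^+,[\cdot,\cdot])$ and $(K^-,-[\cdot,\cdot])$ are Hilbert spaces. With $P_\pm^K$ the corresponding projections onto $K^\pm$, the canonical symmetry is $J=P_+^K-P_-^K$ (the decomposition, hence $J$, is fixed). The form $[x,y]_J=[x,Jy]$ makes $K$ a Hilbert space (the associated Hilbert space) with norm $\|\cdot\|_J$. A subspace $M$ is uniformly $J$-positive (resp. uniformly $J$-negative) if there is $c>0$ with $[x,x]\ge c\|x\|_J^2$ (resp. $-[x,x]\ge c\|x\|_J^2$) for all $x\in M$; maximal means maximal for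 inclusion among such subspaces. $J$-frame: let $\{f_i\}_{i\in I}$ be a Bessel sequence in the associated Hilbert space (here $I$ is finite), with synthesis operator $T:\ell^2(I)\to K$, $T(\{c_i\})=\sum_i c_if_i$. Put $I_+=\{i:[f_i,f_i]\ge 0\}$, $I_-=\{i:[f_i,f_i]<0\}$, let $P_\pm$ be the orthogonal projection of $\ell^2(I)$ onto $\ell^2(I_\pm)$, $T_\pm=TP_\pm$, and $M_\pm=\overline{\mathrm{span}}\{f_i:i\in I_\pm\}$. The sequence is a $J$-frame for $K$ if the range $R(T_+)$ is a maximal uniformly $J$-positive subspace and $R(T_-)$ is a maximal uniformly $J$-negative subspace of $K$. The number $\zeta$ associated with a $J$-frame is $\zeta=c_0(M_+,C)+c_0(M_-,C)$, where $C=\{n\in K:[n,n]=0\}$, $$c_0(M_+,C)=\tfrac{1}{\sqrt2}\Big(\sqrt{\tfrac{1+\alpha^+}{2}}+\sqrt{\tfrac{1-\alpha^+}{2}}\Big),\quad c_0(M_-,C)=\tfrac{1}{\sqrt2}\Big(\sqrt{\tfrac{1+\beta^+}{2}}+\sqrt{\tfrac{1-\beta^+}{2}}\Big),$$ with $\alpha^+=\gamma(G_{M_+})$, $\beta^+=\gamma(G_{M_-})$. Here $G_M=P_MJP_M$ is the Gramian operator of $M$ ($P_M$ being the orthogonal projection onto $M$ in the associated Hilbert space) and $\gamma(S)=\inf\{\|Sx\|_J: x\in (\ker S)^\perp,\ \|x\|_J=1\}$ is the reduced minimum modulus. One has $\zeta\in[\sqrt2,2)$; a $J$-frame with associated number $\zeta$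 is called a $\zeta$-$J$-frame, so every $J$-frame is a $\zeta$-$J$-frame for its own $\zeta$. A $\zeta$-$J$-frame is $\zeta$-$J$-tight if there are constants $A_+,A_-$ with $A_\pm[f,f]=\sum_{i\in I_\pm}|[f,f_i]|^2$ for all $f\in M_\pm$. It is weakly normalized if $[f_i,f_i]=1$ for all $i\in I_+$ and $[f_i,f_i]=-1$ for all $i\in I_-$. The $J$-frame potential of a finite $\zeta$-$J$-frame is $$FP_J(\{f_i:i\in I\})=\sum_{i\in I_+}\sum_{j\in I_+}|[f_i,f_j]|^2+\sum_{i\in I_-}\sum_{j\in I_-}|[f_i,f_j]|^2.$$ *)

(* Defs.v *)
From HB Require Import structures.
From mathcomp Require Import all_boot all_order all_algebra.
From mathcomp Require Import sesquilinear complex.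
From mathcomp Require Import all_classical reals.

Set Implicit Arguments.
Unset Strict Implicit.
Unset Printing Implicit Defensive.

Import Order.TTheory GRing.Theory Num.Theory.

Local Open Scope ring_scope.

Variant scalar_kind := RealScalars | ComplexScalars.

Definition scalarF (R : realType) (k : scalar_kind) : numFieldType :=
  match k with RealScalars => R | ComplexScalars => R[i] end.

Definition conjS (R : realType) (k : scalar_kind) : scalarF R k -> scalarF R k :=
  match k with RealScalars => fun x => x | ComplexScalars => @conjc R end.

Definition reS (R : realType) (k : scalar_kind) : scalarF R k -> R :=
  match k with RealScalars => fun x => x | ComplexScalars => @complex.Re R end.

Section ConjS.
Variables (R : realType) (k : scalar_kind).

Fact conjS_is_zmod_morphism : zmod_morphism (@conjS R k).
Proof. by case: k => //= x y; rewrite rmorphB. Qed.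

Fact conjS_is_monoid_morphism : monoid_morphism (@conjS R k).
Proof. by case: k => //=; split=> [|x y]; rewrite ?rmorph1 ?rmorphM. Qed.

Fact conjS_involutive : involutive (@conjS R k).
Proof. by case: k => //= x; rewrite conjcK. Qed.

HB.instance Definition _ :=
  GRing.isZmodMorphism.Build _ _ (@conjS R k) conjS_is_zmod_morphism.
HB.instance Definition _ :=
  GRing.isMonoidMorphism.Build _ _ (@conjS R k) conjS_is_monoid_morphism.
HB.instance Definition _ :=
  isInvolutive.Build _ (@conjS R k) conjS_involutive.

End ConjS.

(* The carrier is finite-dimensional, so (K^+, [.,.]) and (K^-, -[.,.]) are
   Hilbert spaces as soon as they are inner product spaces. *)
Record krein (R : realType) (k : scalar_kind) (K : vectType (scalarF R k)) :=
  Krein {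
    kform : {hermitian_sym K for @conjS R k};
    kpos : {vspace K};
    kneg : {vspace K};
    kpos_kneg_full : (kpos + kneg)%VS = fullv;
    kpos_kneg_direct : (kpos :&: kneg)%VS = 0%VS;
    kpos_kneg_ortho : {in kpos & kneg, forall x y, kform x y = 0};
    kpos_gt0 : {in kpos, forall x, x != 0 -> 0 < kform x x};
    kneg_lt0 : {in kneg, forall x, x != 0 -> kform x x < 0}
  }.

Section KreinSpace.
Variables (R : realType) (k : scalar_kind) (K : vectType (scalarF R k)).
Variable S : krein K.

Local Notation "[< x , y >]" := (kform S x y) (format "[< x ,  y >]").

Definition symJ : 'End(K) :=
  (daddv_pi (kpos S) (kneg S) - daddv_pi (kneg S) (kpos S))%R.

Definition formJ (x y : K) : scalarF R k := [< x, symJ y >].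

Fact formJ_bilinear :
  bilinear_for (GRing.Scale.Law.clone _ _ *%R _)
    (GRing.Scale.Law.clone _ _ (@conjS R k \; *%R) _) formJ.
Proof.
split=> [y a u v|x a u v]; rewrite /formJ.
  by rewrite linearPl.
by rewrite linearP linearPr.
Qed.

HB.instance Definition _ :=
  bilinear_isBilinear.Build _ _ _ _ _ _ formJ formJ_bilinear.

Fact formJ_herm x y : formJ x y = (-1) ^+ false * conjS (formJ y x).
Proof.
rewrite /formJ /symJ -hermC.
have dec w : w = daddv_pi (kpos S) (kneg S) w + daddv_pi (kneg S) (kpos S) w.
  by rewrite daddv_pi_add ?kpos_kneg_direct ?kpos_kneg_full ?memvf.
have o u v : [< daddv_pi (kpos S) (kneg S) u, daddv_pi (kneg S) (kpos S) v >] = 0.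
  by rewrite kpos_kneg_ortho ?memv_pi.
have o' u v : [< daddv_pi (kneg S) (kpos S) u, daddv_pi (kpos S) (kneg S) v >] = 0.
  by rewrite hermC o rmorph0 mulr0.
rewrite {1}[x]dec {2}[y]dec !lfunE /= !linearDl !linearDr /= !lfunE /=.
by rewrite !linearNr !linearNl /= !o !o' ?(oppr0, subr0) ?(addr0, add0r).
Qed.

HB.instance Definition _ :=
  isHermitianSesquilinear.Build _ _ false (@conjS R k) formJ formJ_herm.

Definition normJ (x : K) : R := Num.sqrt (reS (formJ x x)).

Definition unif_pos (M : {vspace K}) : Prop :=
  exists2 c : R, 0 < c &
    {in M, forall x, c * normJ x ^+ 2 <= reS [< x, x >]}.

Definition unif_neg (M : {vspace K}) : Prop :=
  exists2 c : R, 0 < c &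
    {in M, forall x, c * normJ x ^+ 2 <= - reS [< x, x >]}.

Definition max_vspace (P : {vspace K} -> Prop) (M : {vspace K}) : Prop :=
  P M /\ forall M', P M' -> (M <= M')%VS -> M' = M.

Definition orthoJ (M : {vspace K}) : {vspace K} := orthov formJ M.

Definition projJ (M : {vspace K}) : 'End(K) := daddv_pi M (orthoJ M).

Definition gram (M : {vspace K}) : 'End(K) := (projJ M \o symJ \o projJ M)%VF.

(* If no such x exists (A = 0), this is inf set0 = 0. *)
Definition red_min_mod (A : 'End(K)) : R :=
  inf [set r : R | exists x : K,
    [/\ x \in orthoJ (lker A), normJ x = 1 & r = normJ (A x)]]%classic.

Definition c0 (M : {vspace K}) : R :=
  let a := red_min_mod (gram M) in
  (Num.sqrt 2)^-1 * (Num.sqrt ((1 + a) / 2) + Num.sqrt ((1 - a) / 2)).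

Section Frame.
Variables (I : finType) (f : I -> K).

Definition Ipos : {set I} := [set i | 0 <= [< f i, f i >]].
Definition Ineg : {set I} := [set i | [< f i, f i >] < 0].

Definition synth (c : {ffun I -> (scalarF R k)^o}) : K := \sum_i c i *: f i.

Fact synth_linear : linear synth.
Proof.
move=> a u v; rewrite /synth scaler_sumr -big_split /=.
by apply: eq_bigr => i _; rewrite !ffunE scalerDl scalerA.
Qed.

HB.instance Definition _ := GRing.isLinear.Build _ _ _ _ synth synth_linear.

Definition coord_proj (A : {set I}) (c : {ffun I -> (scalarF R k)^o}) :
  {ffun I -> (scalarF R k)^o} := [ffun i => if i \in A then c i else 0].

Fact coord_proj_linear A : linear (coord_proj A).
Proof.
move=> a u v; apply/ffunP=> i; rewrite !ffunE.
by case: ifP => // _; rewrite scaler0 addr0.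
Qed.

HB.instance Definition _ A :=
  GRing.isLinear.Build _ _ _ _ (coord_proj A) (coord_proj_linear A).

Definition synthop_on (A : {set I}) : 'Hom({ffun I -> (scalarF R k)^o}, K) :=
  (linfun synth \o linfun (coord_proj A))%VF.

(* Every finite family is a Bessel sequence. *)
Definition J_frame : Prop :=
  max_vspace unif_pos (limg (synthop_on Ipos)) /\
  max_vspace unif_neg (limg (synthop_on Ineg)).

Definition Mpos : {vspace K} := <<[seq f i | i in Ipos]>>%VS.
Definition Mneg : {vspace K} := <<[seq f i | i in Ineg]>>%VS.

Definition zeta : R := c0 Mpos + c0 Mneg.

Definition zeta_J_frame (z : R) : Prop := J_frame /\ zeta = z.

Definition weakly_normalized : Prop :=
  {in Ipos, forall i, [< f i, f i >] = 1} /\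
  {in Ineg, forall i, [< f i, f i >] = -1}.

Definition zeta_J_tight (z : R) : Prop :=
  zeta_J_frame z /\
  exists Apos Aneg : R,
    {in Mpos, forall g,
       Apos * reS [< g, g >] = \sum_(i in Ipos) reS `|[< g, f i >]| ^+ 2} /\
    {in Mneg, forall g,
       Aneg * reS [< g, g >] = \sum_(i in Ineg) reS `|[< g, f i >]| ^+ 2}.

Definition FPJ : R :=
  \sum_(i in Ipos) \sum_(j in Ipos) reS `|[< f i, f j >]| ^+ 2 +
  \sum_(i in Ineg) \sum_(j in Ineg) reS `|[< f i, f j >]| ^+ 2.

Definition has_parameters (m n p q : nat) : Prop :=
  [/\ \dim Mpos = m, \dim Mneg = n, #|Ipos| = p & #|Ineg| = q].

Definition admissible (m n p q : nat) : Prop :=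
  [/\ exists z : R, zeta_J_frame z, weakly_normalized & has_parameters m n p q].

End Frame.

(* The index set is not fixed: only its two cardinalities p and q are. *)
Definition FPJ_values (m n p q : nat) : set R :=
  [set v | exists (I : finType) (f : I -> K),
     admissible f m n p q /\ FPJ f = v]%classic.

End KreinSpace.

Definition is_minimum (R : realType) (A : set R) (v : R) : Prop :=
  A v /\ lbound A v.

(* Main.v *)
Require Import Defs.
From HB Require Import structures.
From mathcomp Require Import all_boot all_order all_algebra.
From mathcomp Require Import sesquilinear complex.
From mathcomp Require Import all_classical reals.
From mathcomp Require Import ring lra.

Import Order.TTheory GRing.Theory Num.Theory.
Local Open Scope ring_scope.

Set Implicit Arguments.
Unset Strict Implicit.
Unset Printing Implicit Defensive.

(** The form splits along the two halves of a J-frame: it is positive definite on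
M+ = [Mpos S f], its opposite is positive definite on M- = [Mneg S f], and the
potential is the sum of the two ordinary frame potentials. So everything reduces
to a form B, positive definite on a subspace M of dimension m, and p vectors h_i
of M with B(h_i, h_i) = 1.

Lower bound and equality case. Let T x = sum_i B(x, h_i) h_i be the frame
operator. It is self-adjoint, its trace is p and the trace of its square is the
potential, so for c = p/m and any orthonormal basis e_a of M
    sum_a |T e_a - c e_a|^2 = potential - p^2/m
([potential_defect]). The left side is nonnegative, which is the bound, and it
vanishes exactly when T = c on M, which is tightness ([potential_ge],
[potential_eqP]). A tightness constant, whatever it is, equals p/m when m > 0,
as one sees by taking the trace.

Attainment. A J-frame supplies p >= m vectors of M, so it suffices to produce p
unit vectors forming a tight frame of M ([unit_norm_tight_frame_exists]). The
construction starts from an orthonormal basis scaled by sqrt(p/m) and padded by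
zero vectors. This family is tight, and a rotation (x, y) -> (c x + s y,
- s x + c y) of two of its members keeps it tight. The squared lengths have
average 1; as long as they are not all 1, one is larger and one is smaller than
1, and rotating these two vectors by a suitable angle makes one of them a unit
vector without touching the others. A tight family of unit vectors spans M ([tight_span]), so
replacing each half of the J-frame by such a family keeps M+, M- and the index
sets, hence gives a J-frame with the same parameters.

The range of zeta. With s = sqrt((1+a)/2) and t = sqrt((1-a)/2), where a is the
reduced minimum modulus of the Gramian of M and 0 <= a <= 1, one has
s^2 + t^2 = 1, so 1 <= s + t <= sqrt 2, and the upper bound is strict when a > 0
([c0_bounds]). Uniform definiteness gives a > 0 as soon as M is nonzero
([red_min_mod_gt0]), and M+, M- cannot both vanish: by maximality that would
force K = 0. Hence sqrt 2 <= zeta < 2 for every J-frame ([zeta_bounds]). *)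

(** * Scalars: real numbers inside the field, squared moduli *)

Section Scalars.
Variables (R : realType) (k : scalar_kind).

Definition toS : R -> scalarF R k :=
  match k with RealScalars => id | ComplexScalars => real_complex R end.

Fact toS_is_zmod_morphism : zmod_morphism toS.
Proof. by rewrite /toS; case: k => //= x y; rewrite rmorphB. Qed.

Fact toS_is_monoid_morphism : monoid_morphism toS.
Proof. by rewrite /toS; case: k => //=; split=> [|x y]; rewrite ?rmorph1 ?rmorphM. Qed.

HB.instance Definition _ :=
  GRing.isZmodMorphism.Build _ _ toS toS_is_zmod_morphism.
HB.instance Definition _ :=
  GRing.isMonoidMorphism.Build _ _ toS toS_is_monoid_morphism.

Fact reS_is_zmod_morphism : zmod_morphism (@reS R k).
Proof. by rewrite /reS; case: k => //= [[a b] [c d]]. Qed.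

HB.instance Definition _ :=
  GRing.isZmodMorphism.Build _ _ (@reS R k) reS_is_zmod_morphism.

Lemma reS_toS a : reS (toS a) = a.
Proof. by rewrite /toS /reS; case: k. Qed.

Lemma conjS_toS a : conjS (toS a) = toS a.
Proof. by rewrite /toS /conjS; case: k => //=; exact: conjc_real. Qed.

Lemma reS_toSM a (x : scalarF R k) : reS (toS a * x) = a * reS x.
Proof.
by move: x; rewrite /toS /reS; case: k => //= -[c d] /=; rewrite mul0r subr0.
Qed.

Lemma reS_conjS (x : scalarF R k) : reS (conjS x) = reS x.
Proof. by move: x; rewrite /conjS /reS; case: k => //= -[]. Qed.

Lemma conjS_fixed (x : scalarF R k) : conjS x = x -> x = toS (reS x).
Proof.
move: x; rewrite /conjS /toS /reS; case: k => //= -[c d] /= [dE].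
by apply/eqP; rewrite eq_complex /= eqxx /=; apply/eqP; lra.
Qed.

(** The squared modulus as a real number, in the form in which it occurs in the
frame potential. *)
Definition sqabs (x : scalarF R k) : R := reS `|x| ^+ 2.

Lemma mul_conjS (x : scalarF R k) : x * conjS x = toS (sqabs x).
Proof.
move: x; rewrite /sqabs /conjS /toS /reS; case: k => /= [x|[c d]].
  by rewrite real_normK ?num_real // expr2.
by rewrite -sqr_normc normc_def /= -rmorphXn.
Qed.

Lemma toS_ge0 a : (0 <= toS a) = (0 <= a).
Proof. by rewrite /toS; case: k => //=; rewrite ler0c. Qed.

Lemma toS_gt0 a : (0 < toS a) = (0 < a).
Proof. by rewrite /toS; case: k => //=; rewrite ltcE /= eqxx. Qed.

Lemma toS_lt0 a : (toS a < 0) = (a < 0).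
Proof. by rewrite /toS; case: k => //=; rewrite ltcE /= eqxx. Qed.

Lemma toS_eq0 a : (toS a == 0) = (a == 0).
Proof. exact: fmorph_eq0. Qed.

Lemma reS1 : reS (1 : scalarF R k) = 1.
Proof. by rewrite -(rmorph1 toS) reS_toS. Qed.

End Scalars.
Arguments toS {R} k.

(** * Hermitian forms and their opposites *)

Section Forms.
Variables (R : realType) (k : scalar_kind) (K : vectType (scalarF R k)).
Variable B : {hermitian_sym K for @conjS R k}.

Lemma hformC x y : B x y = conjS (B y x).
Proof. by rewrite hermC expr0 mul1r. Qed.

Lemma form_self x : B x x = toS k (reS (B x x)).
Proof. by apply: conjS_fixed; rewrite -hformC. Qed.

Lemma hformZl a x y : B (a *: x) y = a * B x y.
Proof. by rewrite linearZl_LR. Qed.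

Lemma hformZr a x y : B x (a *: y) = conjS a * B x y.
Proof. by rewrite linearZr_LR. Qed.

Lemma mul_form_conj x y : B x y * B y x = toS k (sqabs (B x y)).
Proof. by rewrite -mul_conjS -hformC. Qed.

Lemma sqabs_formC x y : sqabs (B x y) = sqabs (B y x).
Proof.
by rewrite -[LHS](reS_toS k) -[RHS](reS_toS k) -!mul_form_conj mulrC.
Qed.

Lemma reS_form_scale a x : reS (B (toS k a *: x) (toS k a *: x)) = a ^+ 2 * reS (B x x).
Proof. by rewrite hformZl hformZr conjS_toS !reS_toSM mulrA. Qed.

End Forms.

(** The opposite of the Krein form is positive definite on uniformly negative
subspaces, so that every result on positive definite forms applies to both
halves of a J-frame. *)
Section Opp.
Variables (R : realType) (k : scalar_kind) (K : vectType (scalarF R k)).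
Variable B : {hermitian_sym K for @conjS R k}.
Definition oppform (x y : K) := - B x y.

Fact oppform_bilinear :
  bilinear_for (GRing.Scale.Law.clone _ _ *%R _)
    (GRing.Scale.Law.clone _ _ (@conjS R k \; *%R) _) oppform.
Proof.
by split=> [y a u v|x a u v]; rewrite /oppform ?linearPl ?linearPr /= opprD mulrN.
Qed.
HB.instance Definition _ :=
  bilinear_isBilinear.Build _ _ _ _ _ _ oppform oppform_bilinear.

Fact oppform_herm x y : oppform x y = (-1) ^+ false * conjS (oppform y x).
Proof. by rewrite /oppform rmorphN mulrN -hermC. Qed.
HB.instance Definition _ :=
  isHermitianSesquilinear.Build _ _ false (@conjS R k) oppform oppform_herm.
End Opp.

Section ScalarRotation.
Variables (R : realType) (k : scalar_kind).
Implicit Types (u v : scalarF R k) (c s : R).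

Lemma sqabs_toSM c u : sqabs (toS k c * u) = c ^+ 2 * sqabs u.
Proof.
rewrite -[LHS](reS_toS k) -mul_conjS rmorphM /= conjS_toS mulrACA mul_conjS.
by rewrite -!rmorphM /= reS_toS expr2.
Qed.

(** Real rotations are unitary; this is why rotating two members of a family
leaves its frame operator unchanged. *)
Lemma sqabs_rotate c s u v : c ^+ 2 + s ^+ 2 = 1 ->
  sqabs (toS k c * u + toS k s * v) + sqabs (toS k (- s) * u + toS k c * v) =
  sqabs u + sqabs v.
Proof.
move=> cs1; have cs1' : toS k c ^+ 2 + toS k s ^+ 2 = 1.
  by rewrite -!rmorphXn -rmorphD cs1 rmorph1.
rewrite -[LHS](reS_toS k) -[RHS](reS_toS k) !rmorphD /= -!mul_conjS.
rewrite !rmorphD !rmorphM /= !conjS_toS rmorphN; congr reS.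
set C := toS k c in cs1' *; set D := toS k s in cs1' *.
transitivity ((C ^+ 2 + D ^+ 2) * (u * conjS u + v * conjS v));
  last by rewrite cs1' mul1r.
by ring.
Qed.

Lemma sqabs0 : sqabs (0 : scalarF R k) = 0.
Proof. by apply/eqP; rewrite -(toS_eq0 k) -mul_conjS mul0r. Qed.
End ScalarRotation.

(** * Orthonormal bases of a positive definite subspace *)

Section PosDef.
Variables (R : realType) (k : scalar_kind) (K : vectType (scalarF R k)).
Variable B : {hermitian_sym K for @conjS R k}.

Definition posdef (M : {vspace K}) : Prop :=
  {in M, forall x, x != 0 -> 0 < reS (B x x)}.

Lemma posdef_ge0 M x : posdef M -> x \in M -> 0 <= reS (B x x).
Proof.
move=> Mp xM; have [->|/(Mp x xM)/ltW//] := eqVneq x 0.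
by rewrite linear0l raddf0.
Qed.

Definition onb n (M : {vspace K}) (e : 'I_n -> K) : Prop :=
  [/\ forall a, e a \in M, forall a b, B (e a) (e b) = (a == b)%:R &
      {in M, forall x, x = \sum_a B x (e a) *: e a}].

(** Gram-Schmidt by induction on the dimension: normalize a nonzero vector of
[M] and continue in its orthogonal complement inside [M]. *)
Lemma onb_exists n M : \dim M = n -> posdef M -> exists e, @onb n M e.
Proof.
elim: n M => [|n IHn] M dimM Mp.
  exists (fun=> 0); split=> [[]//|[]//|x].
  by move/eqP: dimM; rewrite dimv_eq0 => /eqP ->; rewrite memv0 big_ord0 => /eqP.
have u0 : vpick M != 0 by rewrite vpick0 -dimv_eq0 dimM.
have uM : vpick M \in M := memv_pick M.
set u := vpick M in u0 uM *; have r0 := Mp u uM u0.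
set r := reS (B u u) in r0 *.
pose e0 := toS k (Num.sqrt r)^-1 *: u.
have e0M : e0 \in M by rewrite memvZ.
have e01 : B e0 e0 = 1.
  rewrite form_self reS_form_scale -/r exprVn sqr_sqrtr ?ltW //.
  by rewrite mulVf ?gt_eqF ?rmorph1.
have e0N : e0 \notin orthov B M.
  by apply/mem_orthovPn; exists e0; rewrite // e01 oner_eq0.
pose M' := (M :&: orthov B <[e0]>)%VS.
have M'p : posdef M' by move=> x /memv_capP[xM _]; apply: Mp.
have M'0 x : x \in M' -> B x e0 = 0 by move=> /memv_capP[_]; rewrite mem_orthov1 => /eqP.
have [|e' [e'M e'o e'x]] := IHn M' _ M'p.
  by rewrite -(eq_dim_orthov1 e0N) dimM.
have B0e' a : B e0 (e' a) = 0 by rewrite hformC M'0 ?rmorph0.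
pose e i := oapp e' e0 (unlift ord0 i).
have el a : e (lift ord0 a) = e' a by rewrite /e liftK.
have e0E : e ord0 = e0 by rewrite /e unlift_none.
exists e; split.
- move=> a; have [b ->|->] := unliftP ord0 a; rewrite ?e0E // el.
  by case/memv_capP: (e'M b).
- move=> a b; have [a' ->|->] := unliftP ord0 a; have [b' ->|->] := unliftP ord0 b.
  + by rewrite !el e'o (inj_eq lift_inj).
  + by rewrite e0E el M'0.
  + by rewrite e0E el B0e'.
  + by rewrite e0E e01 eqxx.
- move=> x xM; rewrite big_ord_recl e0E.
  have x'M : x - B x e0 *: e0 \in M'.
    rewrite memv_cap memvB ?memvZ //= mem_orthov1 linearBl /= hformZl e01.
    by rewrite mulr1 subrr.
  rewrite -[LHS](subrK (B x e0 *: e0)) addrC {1}[x - _]e'x //; congr (_ + _).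
  apply: eq_bigr => a _; rewrite el linearBl /= hformZl B0e'.
  by rewrite mulr0 subr0.
Qed.

Section Basis.
Variables (n : nat) (M : {vspace K}) (e : 'I_n -> K).
Hypotheses (eP : onb M e).

Lemma parseval x y : x \in M -> B x y = \sum_a B x (e a) * B (e a) y.
Proof.
case: eP => _ _ ex xM; rewrite {1}(ex x xM) linear_sumlz.
by apply: eq_bigr => a _; rewrite /= hformZl.
Qed.

Lemma parseval_norm x : x \in M -> reS (B x x) = \sum_a sqabs (B (e a) x).
Proof.
move=> xM; rewrite {1}parseval // raddf_sum /=; apply: eq_bigr => a _.
by rewrite mulrC mul_form_conj reS_toS.
Qed.

Lemma onb_residual x y : y \in M -> B (x - \sum_a B x (e a) *: e a) y = 0.
Proof.
case: eP => _ eo ey yM; rewrite (ey y yM) linear_sumr /=; apply: big1 => b _.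
rewrite hformZr linearBl /= linear_sumlz /= (bigD1 b) //= hformZl eo eqxx mulr1.
rewrite big1 ?addr0 ?subrr ?mulr0 // => a ab.
by rewrite hformZl eo (negPf ab) mulr0.
Qed.
End Basis.

(** * The frame operator and the frame potential *)

Section FrameOperator.
Variables (I : finType) (A : {set I}) (h : I -> K).

Definition frame_op (x : K) : K := \sum_(i in A) B x (h i) *: h i.

Lemma form_frame_op x y : B (frame_op x) y = \sum_(i in A) B x (h i) * B (h i) y.
Proof. by rewrite linear_sumlz; apply: eq_bigr => i _; rewrite /= hformZl. Qed.

Lemma frame_op_selfadj x y : B x (frame_op y) = B (frame_op x) y.
Proof.
rewrite hformC !form_frame_op rmorph_sum; apply: eq_bigr => i _.
by rewrite rmorphM /= -!hformC mulrC.
Qed.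

Lemma form_frame_op_self x :
  reS (B (frame_op x) x) = \sum_(i in A) sqabs (B x (h i)).
Proof.
rewrite form_frame_op raddf_sum /=; apply: eq_bigr => i _.
by rewrite mul_form_conj reS_toS.
Qed.

Definition potential : R :=
  \sum_(i in A) \sum_(j in A) sqabs (B (h i) (h j)).

Definition tight (M : {vspace K}) (c : R) : Prop :=
  {in M, forall x, c * reS (B x x) = \sum_(i in A) sqabs (B x (h i))}.

Variables (n : nat) (M : {vspace K}) (e : 'I_n -> K).
Hypotheses (hM : {in A, forall i, h i \in M}) (eP : onb M e).

Lemma frame_op_in x : frame_op x \in M.
Proof. by apply: memv_suml => i iA; rewrite memvZ ?hM. Qed.

(** The trace of the frame operator is the sum of the squared lengths, because
by Parseval each squared length is the sum of the squared moduli of the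
coordinates. *)
Lemma frame_op_trace :
  \sum_a reS (B (frame_op (e a)) (e a)) = \sum_(i in A) reS (B (h i) (h i)).
Proof.
under eq_bigr do rewrite form_frame_op_self.
rewrite exchange_big /=; apply: eq_bigr => i iA.
by rewrite (parseval_norm eP) ?hM.
Qed.

(** As the frame operator T is self-adjoint, the trace of T^2 is the sum of
the squared lengths of the T e_a; expanding both occurrences of T and contracting
the basis by Parseval leaves the potential. *)
Lemma frame_op_trace_sqr :
  \sum_a reS (B (frame_op (e a)) (frame_op (e a))) = potential.
Proof.
under eq_bigr => a _.
  rewrite form_frame_op raddf_sum /=.
  under eq_bigr => i _ do
    rewrite frame_op_selfadj form_frame_op mulr_sumr raddf_sum /=.
  over.
rewrite exchange_big /=; apply: eq_bigr => i iA.
rewrite exchange_big /=; apply: eq_bigr => j jA.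
rewrite -raddf_sum /= -[RHS](reS_toS k) -mul_form_conj; congr reS.
rewrite [B (h j) _](parseval eP) ?hM // mulr_sumr; apply: eq_bigr => a _.
ring.
Qed.

(** The squared Hilbert-Schmidt distance from the frame operator to [c] times
the identity. *)
Lemma frame_op_defect c :
  \sum_a reS (B (frame_op (e a) - toS k c *: e a) (frame_op (e a) - toS k c *: e a))
  = potential - 2 * c * (\sum_(i in A) reS (B (h i) (h i))) + c ^+ 2 * n%:R.
Proof.
rewrite -frame_op_trace -frame_op_trace_sqr mulr_sumr -sumrB.
have -> : c ^+ 2 * n%:R = \sum_(a < n) c ^+ 2 by rewrite sumr_const card_ord mulr_natr.
rewrite -big_split /=; apply: eq_bigr => a _.
case: eP => _ eo _.
rewrite linearBl linearBr /= !hformZl linearBr linearZr_LR /= conjS_toS.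
rewrite linearZr_LR /= conjS_toS eo eqxx mulr1 [B (e a) _]hformC !raddfB /=.
rewrite !reS_toSM [reS (_ - toS k c)]raddfB /= reS_conjS reS_toS; ring.
Qed.

(** Tightness fixes all the diagonal entries of the frame operator to be [c],
hence determines its trace. *)
Lemma tight_trace c : tight M c -> \sum_(i in A) reS (B (h i) (h i)) = c * n%:R.
Proof.
move=> ct; rewrite -frame_op_trace.
case: eP => eM eo _.
under eq_bigr => a _ do rewrite form_frame_op_self -ct // eo eqxx reS1.
by rewrite sumr_const card_ord mulr1 mulr_natr.
Qed.
End FrameOperator.

(** ** Families of unit vectors *)

Section Bound.
Variables (I : finType) (A : {set I}) (h : I -> K) (M : {vspace K}).
Hypotheses (Mp : posdef M) (hM : {in A, forall i, h i \in M}).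
Hypothesis h1 : {in A, forall i, B (h i) (h i) = 1}.

Let norm_sum : \sum_(i in A) reS (B (h i) (h i)) = #|A|%:R.
Proof. by under eq_bigr => i iA do rewrite h1 // reS1; rewrite sumr_const. Qed.

Lemma unit_frame_dim0 : \dim M = 0 -> #|A| = 0.
Proof.
move=> /eqP; rewrite dimv_eq0 => /eqP M0; apply: eq_card0 => i; apply/negbTE/negP => iA.
have := hM iA; rewrite M0 memv0 => /eqP hi0.
by have := h1 iA; rewrite hi0 linear0l => /esym/eqP; rewrite oner_eq0.
Qed.

Let v : R := #|A|%:R ^+ 2 / (\dim M)%:R.

(** The distance to scalar operators is smallest at [c = p / m]. In dimension 0
there are no unit vectors, so that both quotients by zero have numerator zero. *)
Lemma potential_defect e : @onb (\dim M) M e ->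
  let c : R := #|A|%:R / (\dim M)%:R in
  let D a := frame_op A h (e a) - toS k c *: e a in
  potential A h - v = \sum_a reS (B (D a) (D a)).
Proof.
move=> eP c D; rewrite (frame_op_defect hM eP) norm_sum -addrA; congr (_ + _).
rewrite /c /v; have [d0|d0] := eqVneq (\dim M) 0%N.
  by rewrite (unit_frame_dim0 d0) d0 expr2; ring.
by field; rewrite pnatr_eq0.
Qed.

Lemma potential_ge : v <= potential A h.
Proof.
have [e eP] := onb_exists (erefl _) Mp.
rewrite -subr_ge0 (potential_defect eP); apply: sumr_ge0 => a _.
by case: eP => eM _ _; apply: posdef_ge0 Mp _; rewrite memvB ?frame_op_in ?memvZ.
Qed.

(** If equality holds, the frame operator is scalar on a basis, hence on [M].
Conversely a tightness constant [c] satisfies [c m = p] by taking the trace, and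
summing the tightness identity over the vectors of the family themselves gives
[c p] for the potential. *)
Lemma potential_eqP : potential A h = v <-> exists c, tight A h M c.
Proof.
have [e eP] := onb_exists (erefl _) Mp; have [eM _ _] := eP; split=> [PE|[c ct]].
  have := potential_defect eP; rewrite PE subrr; set c := _ / _ => /esym/eqP.
  have DM a : frame_op A h (e a) - toS k c *: e a \in M.
    by rewrite memvB ?frame_op_in ?memvZ.
  rewrite psumr_eq0 => [/allP D0|a _]; last exact: posdef_ge0 Mp _.
  have SE a : frame_op A h (e a) = toS k c *: e a.
    apply/eqP; rewrite -subr_eq0; apply/negPn/negP => /(Mp (DM a)).
    by rewrite (eqP (D0 a _)) ?ltxx // mem_index_enum.
  exists c => x xM; rewrite -form_frame_op_self -reS_toSM; congr reS.
  rewrite (parseval eP x xM) [RHS](parseval eP) ?frame_op_in // mulr_sumr.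
  apply: eq_bigr => a _; rewrite -frame_op_selfadj SE linearZr_LR /= conjS_toS.
  by rewrite mulrA.
have ctr : #|A|%:R = c * (\dim M)%:R by rewrite -(tight_trace hM eP ct).
have -> : potential A h = c * #|A|%:R.
  rewrite -norm_sum mulr_sumr; apply: eq_bigr => i iA.
  by rewrite ct ?hM.
rewrite /v; have [d0|d0] := eqVneq (\dim M) 0%N.
  by rewrite (unit_frame_dim0 d0) d0 expr2; ring.
by rewrite ctr; field; rewrite pnatr_eq0.
Qed.
End Bound.
End PosDef.

(** * Existence of tight frames of unit vectors *)

Section Existence.
Variables (R : realType) (k : scalar_kind) (K : vectType (scalarF R k)).
Variable B : {hermitian_sym K for @conjS R k}.

Lemma form_comb_r c s z x y :
  B z (toS k c *: x + toS k s *: y) = toS k c * B z x + toS k s * B z y.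
Proof. by rewrite linearDr /= !hformZr !conjS_toS. Qed.

Lemma reS_form_comb c s x y :
  let w := toS k c *: x + toS k s *: y in
  reS (B w w) =
    c ^+ 2 * reS (B x x) + 2 * c * s * reS (B x y) + s ^+ 2 * reS (B y y).
Proof.
move=> w; rewrite {2}/w form_comb_r ![B w _]hformC !form_comb_r.
rewrite raddfD /= !reS_toSM !reS_conjS !raddfD /= !reS_toSM.
by rewrite (hformC B y x) reS_conjS; ring.
Qed.

(** With [a], [b], [d] the squared lengths and the real part of the product, and
[t] the tangent of the angle, the condition on the rotated vector reads
[(1 - b) t^2 - 2 d t - (a - 1) = 0]. The signs of [1 - b] and [a - 1] make the
discriminant nonnegative. *)
Lemma rotate_to_unit x y : 1 < reS (B x x) -> reS (B y y) < 1 ->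
  exists c s : R, c ^+ 2 + s ^+ 2 = 1 /\
    let w := toS k c *: x + toS k s *: y in reS (B w w) = 1.
Proof.
move=> x1 y1; set a := reS (B x x) in x1 *; set b := reS (B y y) in y1 *.
set d := reS (B x y).
pose D := d ^+ 2 + (1 - b) * (a - 1).
have D0 : 0 <= D by rewrite addr_ge0 ?sqr_ge0 // mulr_ge0 // subr_ge0 ltW.
have DE := sqr_sqrtr D0; have b0 : 1 - b != 0 by rewrite subr_eq0 gt_eqF.
pose t := (d + Num.sqrt D) / (1 - b).
have tE : a + 2 * t * d + t ^+ 2 * b = 1 + t ^+ 2.
  apply/eqP; rewrite -subr_eq0; apply/eqP.
  transitivity ((D - Num.sqrt D ^+ 2) / (1 - b)); last by rewrite DE subrr mul0r.
  by rewrite /t /D; field.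
have t0 : 0 < 1 + t ^+ 2 by rewrite ltr_pwDl ?sqr_ge0.
have [c c2] : exists c : R, c ^+ 2 * (1 + t ^+ 2) = 1.
  exists (Num.sqrt (1 + t ^+ 2))^-1.
  by rewrite exprVn sqr_sqrtr ?ltW // mulVf ?gt_eqF.
exists c, (c * t); split; first by rewrite -[RHS]c2; ring.
by rewrite /= reS_form_comb -/a -/b -/d -[RHS]c2 -tE; ring.
Qed.

Variables (I : finType) (A : {set I}) (M : {vspace K}).

Definition rotate_pair (h : I -> K) i j (c s : R) l : K :=
  if l == i then toS k c *: h i + toS k s *: h j else
  if l == j then toS k (- s) *: h i + toS k c *: h j else h l.

Lemma rotate_pair_in h i j c s :
  (forall l, h l \in M) -> forall l, rotate_pair h i j c s l \in M.
Proof.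
by move=> hM l; rewrite /rotate_pair; do 2 ?[case: ifP => _]; rewrite ?memvD ?memvZ.
Qed.

Lemma rotate_pair_tight h i j c s C : i \in A -> j \in A -> i != j ->
  c ^+ 2 + s ^+ 2 = 1 -> tight B A h M C -> tight B A (rotate_pair h i j c s) M C.
Proof.
move=> iA jA ij cs1 hC z zM; rewrite hC //.
have jAi : (j \in A) && (j != i) by rewrite jA eq_sym.
rewrite (bigD1 i) //= (bigD1 j) //= [RHS](bigD1 i) //= [X in _ = _ + X](bigD1 j) //=.
rewrite !addrA; congr (_ + _).
  by rewrite /rotate_pair eqxx eq_sym (negPf ij) eqxx !form_comb_r sqabs_rotate.
by apply: eq_bigr => l /andP[/andP[_ li] lj]; rewrite /rotate_pair (negPf li) (negPf lj).
Qed.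

(** Numbers of average 1 that are not all equal to 1 lie on both sides of 1. *)
Lemma sum_eq1_crossing (q : I -> R) i0 : i0 \in A -> q i0 != 1 ->
  \sum_(i in A) q i = #|A|%:R ->
  exists i j, [/\ i \in A, j \in A, 1 < q i & q j < 1].
Proof.
move=> i0A qi0 qA.
have sum0 : \sum_(i in A) (q i - 1) = 0 by rewrite sumrB qA sumr_const subrr.
have [[i /andP[iA qi]]|no_gt] := pselect (exists i, (i \in A) && (1 < q i)); last first.
  have q_le i : i \in A -> 0 <= - (q i - 1).
    move=> iA; rewrite oppr_ge0 subr_le0 leNgt; apply/negP => qi.
    by apply: no_gt; exists i; rewrite iA.
  have /eqP := sum0; rewrite -oppr_eq0 -sumrN psumr_eq0 // => /allP /(_ i0).
  by rewrite mem_index_enum i0A oppr_eq0 subr_eq0 (negPf qi0) => /(_ isT).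
have [[j /andP[jA qj]]|no_lt] := pselect (exists j, (j \in A) && (q j < 1)); last first.
  have q_ge l : l \in A -> 0 <= q l - 1.
    move=> lA; rewrite subr_ge0 leNgt; apply/negP => ql.
    by apply: no_lt; exists l; rewrite lA.
  have /eqP := sum0; rewrite psumr_eq0 // => /allP /(_ i0).
  by rewrite mem_index_enum i0A subr_eq0 (negPf qi0) => /(_ isT).
by exists i, j; split.
Qed.

(** Induction on the number of vectors of length other than 1. Since the average
of the squared lengths is 1, a too long and a too short vector exist together,
and a rotation of these two makes one of them a unit vector. *)
Lemma tight_normalize n (e : 'I_n -> K) C h : onb B M e -> C * n%:R = #|A|%:R ->
  (forall i, h i \in M) -> tight B A h M C ->
  exists g, [/\ forall i, g i \in M, {in A, forall i, B (g i) (g i) = 1} &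
                tight B A g M C].
Proof.
move=> eP Cn; pose bad g := [set i in A | reS (B (g i) (g i)) != 1].
have [r] := ubnP #|bad h|; elim: r h => // r IHr h badh hM hC.
have [bad0|[i0]] := set_0Vmem (bad h).
  exists h; split=> // i iA; rewrite form_self -(rmorph1 (toS k)); congr toS.
  by have := finset.in_set0 i; rewrite -bad0 inE iA /= => /negbFE/eqP.
rewrite inE => /andP[i0A qi0].
have qA : \sum_(i in A) reS (B (h i) (h i)) = #|A|%:R.
  by rewrite -Cn (tight_trace _ eP hC).
have [i [j [iA jA qi qj]]] := sum_eq1_crossing i0A qi0 qA.
have ij : i != j by apply: contraTneq qi => ->; rewrite -leNgt ltW.
have [c [s [cs1 w1]]] := rotate_to_unit qi qj.
apply: (IHr (rotate_pair h i j c s)); last 2 first.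
- exact: rotate_pair_in.
- exact: rotate_pair_tight.
rewrite ltnS in badh; apply: leq_trans badh; apply: proper_card.
apply/properP; split; last first.
  exists i; rewrite !inE iA /=; first by rewrite gt_eqF.
  by rewrite /rotate_pair eqxx w1 eqxx.
apply/fintype.subsetP => l; rewrite !inE /rotate_pair => /andP[lA].
rewrite lA; have [_|_] := eqVneq l i; first by rewrite w1 eqxx.
by have [-> _|_ /=] := eqVneq l j; first by rewrite /= lt_eqF.
Qed.

(** By Parseval, an orthonormal basis scaled by [sqrt C] is tight with constant
[C], and adding zero vectors changes nothing. *)
Lemma onb_padded_tight n (e : 'I_n -> K) C : onb B M e -> (n <= #|A|)%N -> 0 <= C ->
  exists h, (forall i, h i \in M) /\ tight B A h M C.
Proof.
move=> eP nA C0; have [eM _ _] := eP.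
(* The basis vectors are placed on the first [n] indices of [A]. *)
pose u (a : 'I_n) : I := enum_val (widen_ord nA a).
have u_inj : injective u.
  by move=> a b /enum_val_inj/(congr1 val)/= ab; apply: val_inj.
pose h i := if [pick a | u a == i] is Some a then toS k (Num.sqrt C) *: e a else 0.
have hu a : h (u a) = toS k (Num.sqrt C) *: e a.
  rewrite /h; case: pickP => [b /eqP/u_inj->//|/(_ a)].
  by rewrite eqxx.
exists h; split=> [i|x xM].
  by rewrite /h; case: pickP => [a _|_]; rewrite ?mem0v ?memvZ.
rewrite (parseval_norm eP) // mulr_sumr.
transitivity (\sum_(i in [set u a | a in 'I_n]) sqabs (B x (h i))).
  rewrite big_imset /=; last by move=> a b _ _; apply: u_inj.
  apply: eq_bigr => a _; rewrite hu hformZr conjS_toS sqabs_toSM sqr_sqrtr //.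
  by rewrite sqabs_formC.
rewrite [LHS]big_mkcond [RHS]big_mkcond /=; apply: eq_bigr => i _.
have [/imsetP[a _ ->]|iNu] := boolP (i \in _); first by rewrite enum_valP.
case: ifP => // _; rewrite /h; case: pickP => [a /eqP ua|_].
  by rewrite -ua imset_f in iNu.
by rewrite linear0r sqabs0.
Qed.

Lemma unit_norm_tight_frame_exists : posdef B M -> (\dim M <= #|A|)%N ->
  (\dim M = 0 -> #|A| = 0)%N ->
  exists g c, [/\ forall i, g i \in M, {in A, forall i, B (g i) (g i) = 1} &
                 tight B A g M c].
Proof.
move=> Mp MA M0; have [e eP] := onb_exists (erefl _) Mp.
pose c : R := #|A|%:R / (\dim M)%:R.
have c0 : 0 <= c by rewrite divr_ge0 ?ler0n.
have cn : c * (\dim M)%:R = #|A|%:R.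
  have [d0|d0] := eqVneq (\dim M) 0%N; first by rewrite d0 M0 ?mulr0.
  by rewrite divfK ?pnatr_eq0.
have [h [hM hc]] := onb_padded_tight eP MA c0.
by have [g gP] := tight_normalize eP cn hM hc; exists g, c.
Qed.

(** A vector of [M] orthogonal to the whole family has zero length by tightness,
the constant being nonzero because [c m = p] with [p >= m > 0]. *)
Lemma tight_span g c : posdef B M -> (\dim M <= #|A|)%N ->
  (forall i, g i \in M) -> {in A, forall i, B (g i) (g i) = 1} ->
  tight B A g M c -> <<[seq g i | i in A]>>%VS = M.
Proof.
move=> Mp MA gM g1 gc; set W := <<_>>%VS.
have WM : (W <= M)%VS by apply/span_subvP => y /fintype.imageP[i _ ->].
apply/eqP; rewrite eqEsubv WM /=.
have [/eqP|M0] := eqVneq (\dim M) 0%N; first by rewrite dimv_eq0 => /eqP->; rewrite sub0v.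
have [e eP] := onb_exists (erefl _) Mp.
have c_neq0 : c != 0.
  have := tight_trace (in1W gM) eP gc.
  under eq_bigr => i iA do rewrite g1 // reS1.
  rewrite sumr_const => /eqP; apply: contraTneq => ->.
  by rewrite mul0r pnatr_eq0 -lt0n (leq_trans _ MA) // lt0n.
have Wp : posdef B W by move=> x /(subvP WM); apply: Mp.
have [e' e'P] := onb_exists (erefl _) Wp.
apply/subvP => x xM; set p := \sum_a B x (e' a) *: e' a.
have pW : p \in W by case: e'P => e'W _ _; apply: memv_suml => a _; rewrite memvZ.
have yM : x - p \in M by rewrite memvB // (subvP WM).
suff y0 : x - p = 0 by rewrite -[x](subrK p) y0 add0r pW.
apply/eqP.
apply/negPn/negP => y0; have y_gt0 := Mp _ yM y0; have := gc _ yM.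
rewrite big1 => [/eqP|i iA]; first by rewrite mulf_eq0 (negPf c_neq0) gt_eqF.
rewrite (onb_residual e'P) ?sqabs0 //.
by apply: memv_span; apply: fintype.image_f.
Qed.
End Existence.

(** * Orthogonal projections for a positive definite form *)

Section OrthoProj.
Variables (R : realType) (k : scalar_kind) (K : vectType (scalarF R k)).
Variable B : {hermitian_sym K for @conjS R k}.
Hypothesis Bp : posdef B fullv.
Implicit Types M : {vspace K}.

Lemma posdef_eq0 x : reS (B x x) = 0 -> x = 0.
Proof.
move=> x0; apply/eqP/negPn/negP => /(Bp (memvf x)).
by rewrite x0 ltxx.
Qed.

Lemma orthov_direct M : (M :&: orthov B M = 0)%VS.
Proof.
apply/eqP; rewrite -subv0; apply/subvP => x /memv_capP[xM /mem_orthovP xo].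
by rewrite memv0; apply/eqP/posdef_eq0; rewrite xo // raddf0.
Qed.

Lemma orthov_full M : (M + orthov B M = fullv)%VS.
Proof.
apply/eqP; rewrite eqEsubv subvf /=; apply/subvP => x _.
have [|e eP] := @onb_exists _ _ _ B _ M (erefl _).
  by move=> y _; apply: Bp; rewrite memvf.
have [eM _ _] := eP; rewrite -[x](subrK (\sum_a B x (e a) *: e a)) addrC.
have pM : \sum_a B x (e a) *: e a \in M by apply: memv_suml => a _; rewrite memvZ.
apply: memv_add => //; apply/mem_orthovP => y yM.
by rewrite (onb_residual eP).
Qed.

Lemma proj_orthov M x : x - daddv_pi M (orthov B M) x \in orthov B M.
Proof.
rewrite -{1}(@daddv_pi_add _ _ M (orthov B M) x) ?orthov_direct ?orthov_full ?memvf //.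
by rewrite addrAC subrr add0r memv_pi.
Qed.

Lemma proj_form M x y : y \in M -> B (daddv_pi M (orthov B M) x) y = B x y.
Proof.
move=> yM; apply/eqP; rewrite eq_sym -subr_eq0 -linearBl /=.
by have /mem_orthovP -> := proj_orthov M x.
Qed.

Lemma proj_id M x : x \in M -> daddv_pi M (orthov B M) x = x.
Proof. by move=> xM; rewrite daddv_pi_id ?orthov_direct. Qed.

Lemma proj_pythagoras M x : let p := daddv_pi M (orthov B M) x in
  reS (B x x) = reS (B p p) + reS (B (x - p) (x - p)).
Proof.
move=> p; have pM : p \in M by rewrite memv_pi.
have xp : B (x - p) p = 0 by rewrite linearBl /= proj_form // subrr.
have px : B p (x - p) = 0 by rewrite hformC xp rmorph0.
have xE : x = p + (x - p) by rewrite addrC subrK.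
move: (x - p) xp px xE => q xp px xE.
by rewrite xE linearDl !linearDr /= px xp addr0 add0r raddfD.
Qed.
End OrthoProj.

(** * The reduced minimum modulus and the number zeta *)

Section Krein.
Variables (R : realType) (k : scalar_kind) (K : vectType (scalarF R k)).
Variable S : krein K.

Implicit Types M : {vspace K}.
Local Notation J := (symJ S).
Local Notation BJ := (formJ S).
Local Notation P := (projJ S).
Local Notation "[< x , y >]" := (kform S x y) (format "[< x ,  y >]").

Lemma daddv_pi_eq0 (U V : {vspace K}) x :
  (U :&: V = 0)%VS -> x \in U -> daddv_pi V U x = 0.
Proof.
move=> UV xU; have := @daddv_pi_add _ _ _ _ x UV.
rewrite (subvP (addvSl U V)) // daddv_pi_id // => /(_ isT) /eqP.
by rewrite -subr_eq0 addrAC subrr add0r => /eqP.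
Qed.

Lemma symJ_pos x : x \in kpos S -> J x = x.
Proof.
move=> xp; have pq := kpos_kneg_direct S.
by rewrite /symJ !lfunE /= !lfunE /= daddv_pi_id // daddv_pi_eq0 // subr0.
Qed.

Lemma symJ_neg x : x \in kneg S -> J x = - x.
Proof.
move=> xn; have := kpos_kneg_direct S; rewrite capvC => qp.
by rewrite /symJ !lfunE /= !lfunE /= daddv_pi_eq0 // daddv_pi_id // sub0r.
Qed.

Lemma krein_dec x : exists p q, [/\ p \in kpos S, q \in kneg S & x = p + q].
Proof.
have : x \in (kpos S + kneg S)%VS by rewrite kpos_kneg_full memvf.
by case/memv_addP => p pp [q qn xE]; exists p, q.
Qed.

Lemma symJD p q : p \in kpos S -> q \in kneg S -> J (p + q) = p - q.
Proof. by move=> pp qn; rewrite linearD /= symJ_pos ?symJ_neg. Qed.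

Lemma symJK x : J (J x) = x.
Proof.
have [p [q [pp qn ->]]] := krein_dec x.
by rewrite symJD // symJD ?memvN // opprK.
Qed.

(** The two components are orthogonal, and the canonical symmetry changes the
sign of the negative one: the associated form is therefore positive definite and
invariant under the canonical symmetry. *)
Lemma formJ_dec p q : p \in kpos S -> q \in kneg S ->
  BJ (p + q) (p + q) = [< p, p >] - [< q, q >].
Proof.
move=> pp qn; rewrite /formJ symJD // linearDl !linearBr /=.
have pq : [< p, q >] = 0 by apply: kpos_kneg_ortho.
by rewrite [X in _ + (X - _)]hformC pq rmorph0 subr0 sub0r.
Qed.

Lemma formJ_symJ x : BJ (J x) (J x) = BJ x x.
Proof.
have [p [q [pp qn ->]]] := krein_dec x.
by rewrite symJD // !formJ_dec ?memvN // linearNl linearNr opprK.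
Qed.

Lemma formJ_posdef : posdef BJ fullv.
Proof.
move=> x _ x0; have [p [q [pp qn xE]]] := krein_dec x.
rewrite xE /= formJ_dec // raddfB /=.
have p_gt0 : p != 0 -> 0 < reS [< p, p >].
  by move=> /(kpos_gt0 pp); rewrite form_self toS_gt0 reS_toS.
have q_lt0 : q != 0 -> reS [< q, q >] < 0.
  by move=> /(kneg_lt0 qn); rewrite form_self toS_lt0 reS_toS.
have [p0|/p_gt0 p1] := eqVneq p 0.
  move: x0; rewrite xE p0 add0r linear0l raddf0 => /q_lt0; lra.
have [->|/q_lt0 q1] := eqVneq q 0; last lra.
by rewrite linear0l raddf0; lra.
Qed.

Lemma formJ_ge0 x : 0 <= reS (BJ x x).
Proof. exact: posdef_ge0 formJ_posdef (memvf x). Qed.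

Lemma normJ_sqr x : normJ S x ^+ 2 = reS (BJ x x).
Proof. by rewrite sqr_sqrtr ?formJ_ge0. Qed.

Lemma normJ_ge0 x : 0 <= normJ S x.
Proof. exact: sqrtr_ge0. Qed.

Lemma normJ_eq0 x : normJ S x = 0 -> x = 0.
Proof.
move=> x0; apply: (posdef_eq0 formJ_posdef).
by rewrite -normJ_sqr x0 expr0n.
Qed.

Lemma normJ_proj_le M x : normJ S (P M x) <= normJ S x.
Proof.
rewrite ler_wsqrtr // (proj_pythagoras formJ_posdef M x) lerDl.
exact: formJ_ge0.
Qed.

Lemma gramE M x : gram S M x = P M (J (P M x)).
Proof. by rewrite /gram !comp_lfunE. Qed.

Lemma normJ_gram_le M x : normJ S (gram S M x) <= normJ S x.
Proof.
rewrite gramE; apply: le_trans (normJ_proj_le _ _) _.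
by rewrite {1}/normJ formJ_symJ normJ_proj_le.
Qed.

Definition gram_values M : set R := [set r : R | exists x : K,
  [/\ x \in orthoJ S (lker (gram S M)), normJ S x = 1 &
      r = normJ S (gram S M x)]]%classic.

Lemma gram_values_ge0 M : lbound (gram_values M) 0.
Proof. by move=> _ [x [_ _ ->]]; apply: normJ_ge0. Qed.

Lemma red_min_mod_ge0 M : 0 <= red_min_mod S (gram S M).
Proof.
rewrite /red_min_mod -/(gram_values M).
have [->|ne] := eqVneq (gram_values M) set0; first by rewrite inf0.
by apply: lb_le_inf; [apply/set0P | apply: gram_values_ge0].
Qed.

Lemma red_min_mod_le1 M : red_min_mod S (gram S M) <= 1.
Proof.
rewrite /red_min_mod -/(gram_values M).
have [->|/set0P[r rV]] := eqVneq (gram_values M) set0; first by rewrite inf0.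
have [x [xo x1 rE]] := rV.
apply: (@le_trans _ _ r); last by rewrite rE -x1 normJ_gram_le.
by apply: ge_inf => //; exists 0; apply: gram_values_ge0.
Qed.

(** The factor [sg], which is 1 or -1, treats uniformly positive and uniformly
negative subspaces together. *)
Section Definite.
Variables (M : {vspace K}) (sg c : R).
Hypotheses (sg2 : sg ^+ 2 = 1) (c_gt0 : 0 < c).
Hypothesis Mdef : {in M, forall x, c * normJ S x ^+ 2 <= sg * reS [< x, x >]}.

Lemma gram_form x : x \in M -> reS (BJ (gram S M x) x) = reS [< x, x >].
Proof.
move=> xM; have PE := proj_id formJ_posdef xM.
rewrite gramE /projJ /orthoJ (proj_form formJ_posdef) // PE.
by rewrite (hformC BJ) reS_conjS /= /formJ symJK.
Qed.

(** Expand [0 <= |G x - sg c x|^2] and use [(G x, x)_J = [x, x]] on [M]; this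
replaces the Cauchy-Schwarz inequality. *)
Lemma gram_bounded_below x : x \in M -> c * normJ S x <= normJ S (gram S M x).
Proof.
move=> xM; rewrite -(@ler_sqr _ (c * _)) ?nnegrE ?mulr_ge0 ?normJ_ge0 ?(ltW c_gt0) //.
rewrite exprMn; have := Mdef xM.
have := formJ_ge0 (gram S M x - toS k (sg * c) *: x).
rewrite linearBl linearBr /= !hformZl linearBr /= !hformZr conjS_toS.
rewrite [BJ x (gram _ _ _)]hformC !raddfB /= !reS_toSM raddfB /= reS_toSM reS_conjS.
rewrite gram_form // -!normJ_sqr.
set g := normJ _ _ ^+ 2; set n := normJ _ _ ^+ 2; set b := reS _ => ge0 le1.
have : 0 <= g - 2 * c * (sg * b) + sg ^+ 2 * c ^+ 2 * n by apply: le_trans ge0 _; lra.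
rewrite sg2 mul1r => ge0'.
have : 2 * c * (c * n) <= 2 * c * (sg * b) by rewrite ler_pM2l ?mulr_gt0.
lra.
Qed.

(** The Gramian vanishes on the orthogonal complement of [M] and is injective on
[M], so that its kernel is that complement. *)
Lemma mem_orthoJ_ker x : (x \in orthoJ S (lker (gram S M))) = (x \in M).
Proof.
have projker y : y - P M y \in lker (gram S M).
  rewrite memv_ker gramE linearB /= /projJ /orthoJ.
  by rewrite (proj_id formJ_posdef (memv_pi _ _ _)) subrr !linear0.
apply/idP/idP => [/mem_orthovP xo|xM].
  suff -> : x = P M x by rewrite memv_pi.
  apply/eqP; rewrite -subr_eq0; apply/eqP/(posdef_eq0 formJ_posdef).
  rewrite linearBl /= xo // (hformC BJ).
  have := proj_orthov formJ_posdef M x => /mem_orthovP ->; last by rewrite memv_pi.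
  by rewrite rmorph0 subr0 raddf0.
apply/mem_orthovP => y; rewrite memv_ker => /eqP Gy0.
have Py0 : P M y = 0.
  apply: normJ_eq0; have PM : P M y \in M by rewrite memv_pi.
  have := gram_bounded_below PM; rewrite gramE.
  rewrite [P M (P M y)](proj_id formJ_posdef) // -gramE Gy0.
  rewrite {2}/normJ linear0l raddf0 sqrtr0 pmulr_rle0 // => n0.
  by apply/eqP; rewrite eq_le n0 normJ_ge0.
have := proj_orthov formJ_posdef M y; rewrite -/(P M) Py0 subr0 => /mem_orthovP yo.
by rewrite (hformC BJ) yo ?rmorph0.
Qed.

Lemma red_min_mod_gt0 : M != 0%VS -> 0 < red_min_mod S (gram S M).
Proof.
move=> M0; apply: lt_le_trans c_gt0 _; rewrite /red_min_mod -/(gram_values M).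
have u0 : vpick M != 0 by rewrite vpick0.
have uM : vpick M \in M := memv_pick M; set u := vpick M in u0 uM.
have nu0 : normJ S u != 0 by apply: contra_neq u0; apply: normJ_eq0.
apply: lb_le_inf.
  pose x := toS k (normJ S u)^-1 *: u.
  exists (normJ S (gram S M x)), x; split=> //.
    by rewrite mem_orthoJ_ker memvZ.
  by rewrite /normJ reS_form_scale -normJ_sqr -exprMn mulVf // expr1n sqrtr1.
move=> _ [x [xM x1 ->]]; rewrite mem_orthoJ_ker in xM.
by have := gram_bounded_below xM; rewrite x1 mulr1.
Qed.
End Definite.

(** With [s] and [t] the two square roots, [s^2 + t^2 = 1] gives
[1 <= (s + t)^2 = 2 - (s - t)^2 <= 2], and [s = t] only if the modulus is 0. *)
Lemma c0_bounds M : [/\ (Num.sqrt 2)^-1 <= c0 S M, c0 S M <= 1 &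
  0 < red_min_mod S (gram S M) -> c0 S M < 1].
Proof.
rewrite /c0; have := red_min_mod_ge0 M; have := red_min_mod_le1 M.
set a := red_min_mod _ _ => a1 a0.
have s2 : Num.sqrt ((1 + a) / 2) ^+ 2 = (1 + a) / 2 by rewrite sqr_sqrtr //; lra.
have t2 : Num.sqrt ((1 - a) / 2) ^+ 2 = (1 - a) / 2 by rewrite sqr_sqrtr //; lra.
have s0 := sqrtr_ge0 ((1 + a) / 2); have t0 := sqrtr_ge0 ((1 - a) / 2).
set s := Num.sqrt _ in s2 s0 *; set t := Num.sqrt ((1 - a) / 2) in t2 t0 *.
have r0 : 0 < Num.sqrt 2 :> R by rewrite sqrtr_gt0.
have r2 : Num.sqrt 2 ^+ 2 = 2 :> R by rewrite sqr_sqrtr.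
set r := Num.sqrt 2 in r0 r2 *.
have st : (s + t) ^+ 2 = 2 - (s - t) ^+ 2.
  have -> : 2 = (s ^+ 2 + t ^+ 2) * 2 by rewrite s2 t2; lra.
  by ring.
have stp : 0 <= s * t by apply: mulr_ge0.
split.
- apply: ler_peMr; first by rewrite invr_ge0 ltW.
  rewrite -(@ler_sqr _ 1) ?nnegrE ?addr_ge0 //.
  by rewrite expr1n sqrrD s2 t2; lra.
- rewrite mulrC ler_pdivrMr // mul1r -(@ler_sqr _ (s + t)) ?nnegrE ?addr_ge0 ?(ltW r0) //.
  by rewrite st r2 gerBl sqr_ge0.
- move=> a_gt0; rewrite mulrC ltr_pdivrMr // mul1r.
  rewrite -(@ltr_sqr _ (s + t)) ?nnegrE ?addr_ge0 ?(ltW r0) //.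
  rewrite st r2 gtrBl lt_neqAle sqr_ge0 andbT eq_sym sqrf_eq0 subr_eq0.
  by apply: contraTneq a_gt0 => stE; move: s2; rewrite stE t2 -leNgt => tE; lra.
Qed.
End Krein.

(** * J-frames *)

Section JFrames.
Variables (R : realType) (k : scalar_kind) (K : vectType (scalarF R k)).
Variable S : krein K.
Local Notation B := (kform S).
Local Notation "[< x , y >]" := (kform S x y) (format "[< x ,  y >]").

Section Family.
Variables (I : finType) (f : I -> K).

Lemma limg_synthop_on (A : {set I}) :
  limg (synthop_on f A) = <<[seq f i | i in A]>>%VS.
Proof.
apply/eqP; rewrite eqEsubv; apply/andP; split; apply/subvP => x.
  case/memv_imgP => c _ ->; rewrite comp_lfunE !lfunE /= /synth.
  apply: memv_suml => i _; rewrite ffunE; case: ifP => [iA|_].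
    by rewrite memvZ // memv_span // fintype.image_f.
  by rewrite scale0r mem0v.
apply: (subvP _ x); apply/span_subvP => y /fintype.imageP[i iA ->].
pose d : {ffun I -> (scalarF R k)^o} := [ffun j => (j == i)%:R].
suff -> : f i = synthop_on f A d by rewrite memv_img ?memvf.
rewrite comp_lfunE !lfunE /= /synth (bigD1 i) //= !ffunE iA eqxx scale1r.
rewrite big1 ?addr0 // => j ji.
by rewrite !ffunE (negPf ji) if_same scale0r.
Qed.

Lemma unif_pos_posdef M : unif_pos S M -> posdef B M.
Proof.
move=> [c c0 Mc] x xM x0; apply: lt_le_trans (Mc x xM).
by rewrite normJ_sqr mulr_gt0 // (@formJ_posdef _ _ _ S x (memvf x)).
Qed.

Lemma unif_neg_posdef M : unif_neg S M -> posdef (oppform B) M.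
Proof.
move=> [c c0 Mc] x xM x0; rewrite /= /oppform raddfN.
apply: lt_le_trans (Mc x xM).
by rewrite normJ_sqr mulr_gt0 // (@formJ_posdef _ _ _ S x (memvf x)).
Qed.

Lemma J_frameE : J_frame S f <->
  max_vspace (unif_pos S) (Mpos S f) /\ max_vspace (unif_neg S) (Mneg S f).
Proof. by rewrite /J_frame !limg_synthop_on. Qed.

Lemma kpos_unif_pos : unif_pos S (kpos S).
Proof.
exists 1 => // x xp; rewrite mul1r normJ_sqr -[in leLHS](addr0 x).
by rewrite /= formJ_dec ?mem0v // linear0l subr0.
Qed.

Lemma kneg_unif_neg : unif_neg S (kneg S).
Proof.
exists 1 => // x xn; rewrite mul1r normJ_sqr -[in leLHS](add0r x).
by rewrite /= formJ_dec ?mem0v // linear0l sub0r raddfN.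
Qed.

Lemma max_vspace_eq0 (Q : {vspace K} -> Prop) (M M' : {vspace K}) :
  max_vspace Q M -> Q M' -> M = 0%VS -> M' = 0%VS.
Proof. by move=> [_ Mmax] QM' M0; rewrite (Mmax M') // M0 sub0v. Qed.

(** Each of the two terms lies between [1 / sqrt 2] and 1. At least one of them
is smaller than 1: otherwise both subspaces are zero, and then by maximality so
are [kpos S] and [kneg S]. *)
Lemma zeta_bounds : (0 < \dim {:K})%N -> J_frame S f ->
  Num.sqrt 2 <= zeta S f < 2.
Proof.
move=> K0 /J_frameE[Pmax Nmax].
have [c c0 Pc] := Pmax.1; have [d d0 Nd] := Nmax.1.
have Pc' : {in Mpos S f, forall x, c * normJ S x ^+ 2 <= 1 * reS [< x, x >]}.
  by move=> x xM; rewrite mul1r Pc.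
have Nd' : {in Mneg S f, forall x, d * normJ S x ^+ 2 <= -1 * reS [< x, x >]}.
  by move=> x xM; rewrite mulN1r Nd.
have [P1 P2 P3] := c0_bounds S (Mpos S f); have [N1 N2 N3] := c0_bounds S (Mneg S f).
rewrite /zeta; apply/andP; split.
  have r0 : 0 < Num.sqrt 2 :> R by rewrite sqrtr_gt0.
  have -> : Num.sqrt 2 = (Num.sqrt 2)^-1 + (Num.sqrt 2)^-1 :> R.
    apply: (mulfI (lt0r_neq0 r0)); rewrite mulrDr mulfV ?gt_eqF //.
    by rewrite -expr2 sqr_sqrtr.
  exact: lerD.
have [P0|P0] := eqVneq (Mpos S f) 0%VS; last first.
  exact: ltr_leD (P3 (@red_min_mod_gt0 _ _ _ _ _ 1 c (expr1n _ 2) c0 Pc' P0)) N2.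
have [N0|N0] := eqVneq (Mneg S f) 0%VS; last first.
  exact: ler_ltD P2 (N3 (@red_min_mod_gt0 _ _ _ _ _ (-1) d (sqrr_sign _ 1) d0 Nd' N0)).
move: K0; rewrite -(kpos_kneg_full S).
rewrite (max_vspace_eq0 Pmax kpos_unif_pos P0) (max_vspace_eq0 Nmax kneg_unif_neg N0).
by rewrite add0v dimv0.
Qed.

Lemma sqabsN (x : scalarF R k) : sqabs (- x) = sqabs x.
Proof. by rewrite /sqabs normrN. Qed.

Lemma FPJE :
  FPJ S f = potential B (Ipos S f) f + potential (oppform B) (Ineg S f) f.
Proof.
congr (_ + _); apply: eq_bigr => i _; apply: eq_bigr => j _.
by rewrite [RHS]sqabsN.
Qed.

Lemma tight_oppform (A : {set I}) M c : tight (oppform B) A f M c <->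
  {in M, forall g, - c * reS [< g, g >] = \sum_(i in A) reS `|[< g, f i >]| ^+ 2}.
Proof.
by split=> fc x xM; have := fc x xM;
  rewrite /= /oppform raddfN mulrN mulNr => ->; apply: eq_bigr => i _;
  rewrite ?[LHS]sqabsN ?[RHS]sqabsN.
Qed.

Lemma Ipos_in : {in Ipos S f, forall i, f i \in Mpos S f}.
Proof. by move=> i iA; apply: memv_span; apply: fintype.image_f. Qed.

Lemma Ineg_in : {in Ineg S f, forall i, f i \in Mneg S f}.
Proof. by move=> i iA; apply: memv_span; apply: fintype.image_f. Qed.

Lemma mem_IposE i : (i \in Ipos S f) = (0 <= reS [< f i, f i >]).
Proof. by rewrite inE form_self toS_ge0 reS_toS. Qed.

Lemma mem_InegE i : (i \in Ineg S f) = (i \notin Ipos S f).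
Proof. by rewrite mem_IposE inE form_self toS_lt0 reS_toS ltNge. Qed.

Lemma dim_Mpos_le : (\dim (Mpos S f) <= #|Ipos S f|)%N.
Proof. by rewrite (leq_trans (dim_span _)) // size_image. Qed.

Lemma dim_Mneg_le : (\dim (Mneg S f) <= #|Ineg S f|)%N.
Proof. by rewrite (leq_trans (dim_span _)) // size_image. Qed.

End Family.

Section FramePotential.
Variables (I : finType) (f : I -> K).
Hypotheses (f_frame : J_frame S f) (f_norm : weakly_normalized S f).

Let Pp : posdef B (Mpos S f).
Proof. by apply: unif_pos_posdef; case/J_frameE: f_frame => -[]. Qed.
Let Np : posdef (oppform B) (Mneg S f).
Proof. by apply: unif_neg_posdef; case/J_frameE: f_frame => _ -[]. Qed.

Let P1 : {in Ipos S f, forall i, B (f i) (f i) = 1}.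
Proof. by case: f_norm. Qed.
Let N1 : {in Ineg S f, forall i, oppform B (f i) (f i) = 1}.
Proof. by case: f_norm => _ fN i iA; rewrite /oppform fN ?opprK. Qed.

Let v : R := #|Ipos S f|%:R ^+ 2 / (\dim (Mpos S f))%:R +
  #|Ineg S f|%:R ^+ 2 / (\dim (Mneg S f))%:R.

Lemma FPJ_ge : v <= FPJ S f.
Proof.
by rewrite FPJE lerD //; apply: potential_ge => //; [apply: Ipos_in | apply: Ineg_in].
Qed.

Lemma FPJ_eqP : FPJ S f = v <-> exists Apos Aneg : R,
    {in Mpos S f, forall g,
       Apos * reS [< g, g >] = \sum_(i in Ipos S f) reS `|[< g, f i >]| ^+ 2} /\
    {in Mneg S f, forall g,
       Aneg * reS [< g, g >] = \sum_(i in Ineg S f) reS `|[< g, f i >]| ^+ 2}.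
Proof.
have Pge := potential_ge Pp (@Ipos_in _ _) P1.
have Nge := potential_ge Np (@Ineg_in _ _) N1.
have Peq := potential_eqP Pp (@Ipos_in _ _) P1.
have Neq := potential_eqP Np (@Ineg_in _ _) N1.
rewrite FPJE; split=> [vE|[a [b [ha hb]]]].
  have /Peq[a ha] : potential B (Ipos S f) f = #|Ipos S f|%:R ^+ 2 / (\dim (Mpos S f))%:R.
    by apply/eqP; rewrite eq_le Pge andbT; rewrite /v in vE; lra.
  have /Neq[b hb] : potential (oppform B) (Ineg S f) f =
      #|Ineg S f|%:R ^+ 2 / (\dim (Mneg S f))%:R.
    by apply/eqP; rewrite eq_le Nge andbT; rewrite /v in vE; lra.
  by exists a, (- b); split=> //; apply/tight_oppform.
congr (_ + _); first by apply/Peq; exists a.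
by apply/Neq; exists (- b); apply/tight_oppform; rewrite opprK.
Qed.

(** Both halves are replaced by tight families of unit vectors spanning the same
subspaces, on the same indices. Maximality only involves the two spans, so the
new family is again a J-frame. *)
Lemma tight_J_frame_exists : exists h : I -> K,
  [/\ J_frame S h, weakly_normalized S h,
      [/\ Ipos S h = Ipos S f, Ineg S h = Ineg S f, Mpos S h = Mpos S f &
          Mneg S h = Mneg S f] & FPJ S h = v].
Proof.
have [] := unit_norm_tight_frame_exists Pp (dim_Mpos_le _).
  exact: unit_frame_dim0 (@Ipos_in _ _) P1.
move=> g [a [gM g1 ga]].
have [] := unit_norm_tight_frame_exists Np (dim_Mneg_le _).
  exact: unit_frame_dim0 (@Ineg_in _ _) N1.
move=> g' [b [g'M g'1 g'b]].
pose h i := if i \in Ipos S f then g i else g' i.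
have hP i : i \in Ipos S f -> h i = g i by rewrite /h => ->.
have hN i : i \in Ineg S f -> h i = g' i by rewrite mem_InegE /h => /negPf ->.
have hP1 i : i \in Ipos S f -> [< h i, h i >] = 1 by move=> iP; rewrite hP ?g1.
have hN1 i : i \in Ineg S f -> [< h i, h i >] = -1.
  by move=> iN; rewrite hN // -[LHS]opprK; congr (- _); apply: g'1.
have IP : Ipos S h = Ipos S f.
  apply/setP => i; rewrite mem_IposE; case: (boolP (i \in Ipos S f)) => iP.
    by rewrite hP1 // reS1 ler01.
  by rewrite hN1 ?mem_InegE // raddfN /= reS1 oppr_ge0 ler10.
have IN : Ineg S h = Ineg S f by apply/setP => i; rewrite !mem_InegE IP.
have MP : Mpos S h = Mpos S f.
  rewrite -(tight_span Pp (dim_Mpos_le _) gM g1 ga) /Mpos IP.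
  by congr <<_>>%VS; apply/eq_in_map => i; rewrite mem_enum => /hP.
have MN : Mneg S h = Mneg S f.
  rewrite -(tight_span Np (dim_Mneg_le _) g'M g'1 g'b) /Mneg IN.
  by congr <<_>>%VS; apply/eq_in_map => i; rewrite mem_enum => /hN.
exists h; split=> //.
- by apply/J_frameE; rewrite MP MN; apply/J_frameE.
- by split=> i; rewrite ?IP ?IN; [apply: hP1 | apply: hN1].
rewrite FPJE IP IN /v; congr (_ + _).
- apply/(potential_eqP Pp).
  + by move=> i iP; rewrite hP.
  + by move=> i iP; rewrite hP1.
  + exists a => x xM; rewrite ga //; apply: eq_bigr => i iP.
    by rewrite hP.
- apply/(potential_eqP Np).
  + by move=> i iN; rewrite hN.
  + by move=> i iN; rewrite hN ?g'1.
  + exists b => x xM; rewrite g'b //; apply: eq_bigr => i iN.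
    by rewrite hN.
Qed.
End FramePotential.
End JFrames.

Theorem theorem3p15 (R : realType) (k : scalar_kind)
    (K : vectType (scalarF R k)) (S : krein K)
    (N : nat) (dimK : \dim {:K} = N) (N_gt0 : (0 < N)%N)
    (I : finType) (f : I -> K) (z : R)
    (f_frame : zeta_J_frame S f z) (f_norm : weakly_normalized S f)
    (m n p q : nat)
    (dim_Mpos : \dim (Mpos S f) = m) (dim_Mneg : \dim (Mneg S f) = n)
    (card_Ipos : #|Ipos S f| = p) (card_Ineg : #|Ineg S f| = q) :
  let v : R := p%:R ^+ 2 / m%:R + q%:R ^+ 2 / n%:R in
  is_minimum (FPJ_values S m n p q) v /\
  (forall (I' : finType) (g : I' -> K), admissible S g m n p q ->
     (FPJ S g = v <->
      weakly_normalized S g /\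
      exists z' : R, [/\ Num.sqrt 2 <= z', z' < 2 & zeta_J_tight S g z'])).
Proof.
move=> v; split; first split.
- have [h [hF hN [IP IN MP MN] hv]] := tight_J_frame_exists f_frame.1 f_norm.
  exists I, h; split; last by rewrite hv dim_Mpos dim_Mneg card_Ipos card_Ineg.
  split=> //; first by exists (zeta S h).
  by rewrite /has_parameters IP IN MP MN.
- move=> _ [I' [g [[[z' [gF _]] gN [dP dN cP cN]] <-]]].
  by have := FPJ_ge gF gN; rewrite dP dN cP cN.
move=> I' g [[z' [gF _]] gN [dP dN cP cN]].
have := FPJ_eqP gF gN; rewrite dP dN cP cN -/v => ->.
have /andP[z_ge z_lt] : Num.sqrt 2 <= zeta S g < 2 by apply: zeta_bounds; rewrite ?dimK.
split=> [gT|[_ [z'' [_ _ [_ gT]]]]//].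
by split=> //; exists (zeta S g); split.
Qed.
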